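(* Let $\mathbb{K}=\mathbb{C}$, $q\in(0,1)$, and let $p$ be a $q^2$-separable polynomial with real coefficients. Equip $\mathcal{A}(p;q)$ with the $*$-algebra structure $z_-^*=z_+$, $x_-^*=x_+$, and let $\Omega$ be the first-order $*$-calculus on $\mathcal{A}(p;q)$ described in the context. View $\mathcal{B}(p;q)$ as the ($*$-sub)algebra $\mathcal{A}(p;q)_0$ of $\mathcal{A}(p;q)$, and let $\mathcal{S}$, $D$ and $\gamma$ be the spinor module, Dirac operator and grading described in the context. Choose $\beta_+,\beta_-$ such that $\beta_-^*/\beta_+<0$, and let $\nu$ be a solution to the equation $$\nu^2=-q^3\,\frac{\beta_-^*}{\beta_+}.$$ Then the antilinear map $$J:\mathcal{S}\to\mathcal{S},\qquad a\,\mathsf{s}_++b\,\mathsf{s}_-\longmapsto-\nu^{-1}b^*\mathsf{s}_++\nu a^*\mathsf{s}_-,$$ equips $D$ with a real structure such that $D$ has $\mathrm{KO}$-dimension two; that is, $$J^2=-\operatorname{id},\qquad J\circ\gamma=-\gamma\circ J,\qquad J\circ D=D\circ J,$$ and, for all $u,v\in\mathcal{B}(p;q)$, $$[u,JvJ]=0,\qquad [[D,u],JvJ]=0,$$ where $[-,-]$ denotes the commutator of operators on $\mathcal{S}$ and elements of $\mathcal{B}(p;q)$ act on $\mathcal{S}$ by left multiplication.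
   Context: $p_{q^2}(z):=\frac{p(q^2z)-p(z)}{(q^2-1)z}$ is the $q^2$-derivative of $p$; $p$ is $q^2$-separable if $p(z)$ is coprime with $zp_{q^2}(z)$. For scalars, $*$ denotes complex conjugation. $\mathcal{A}(p;q)$ is the complex unital associative algebra generated by $x_+,x_-,z_+,z_-$ subject to the relations $$z_+z_-=z_-z_+,\quad x_+z_\pm=q^{-1}z_\pm x_+,\quad x_-z_\pm=q z_\pm x_-,\quad x_+x_-=p(z_+z_-),\quad x_-x_+=p(q^2z_-z_+).$$ It is $\mathbb{Z}$-graded by $|z_\pm|=|x_\pm|=\pm1$, with degree-$k$ component $\mathcal{A}(p;q)_k$. $\mathcal{B}(p;q)$ is the algebra generated by $x,y,z$ subject to $xz=q^2zx$, $yz=q^{-2}zy$, $xy=q^2zp(q^2z)$, $yx=zp(z)$, identified with $\mathcal{A}(p;q)_0$ through the isomorphism $x\mapsto x_-z_+$, $y\mapsto z_-x_+$, $z\mapsto z_-z_+$ (with $z^*=z$, $x^*=y$). Define algebra automorphisms of $\mathcal{A}(p;q)$ on homogeneous elements by $\sigma_\pm(a)=q^{|a|}a$, $\sigma_0(a)=q^{2|a|}a$. Put $z=z_+z_-$ and $c(z)=q\,p_{q^2}(z)$. Fix nonzero $\alpha_0\in\mathbb{R}$ and nonzero $\alpha_+,\alpha_-\in\mathbb{C}$ with $\alpha_-^*=q\alpha_+$. The linear maps $\partial_i$, $i\in\{-,0,+\}$, are the skew $\sigma_i$-derivations of $\mathcal{A}(p;q)$ (i.e. $\partial_i(ab)=\partial_i(a)\sigma_i(b)+a\partial_i(b)$)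 given on generators by - $\partial_0(x_+)=\alpha_0x_+$, $\partial_0(x_-)=-q^{-2}\alpha_0x_-$, $\partial_0(z_+)=\alpha_0z_+$, $\partial_0(z_-)=-q^{-2}\alpha_0z_-$; - $\partial_-(x_+)=\partial_-(z_+)=0$, $\partial_-(x_-)=\alpha_-c(z)z_+$, $\partial_-(z_-)=\alpha_-x_+$; - $\partial_+(x_-)=\partial_+(z_-)=0$, $\partial_+(x_+)=\alpha_+c(z)z_-$, $\partial_+(z_+)=\alpha_+x_-$. Calculus: $\Omega$ is the free left $\mathcal{A}(p;q)$-module with basis $\omega_-,\omega_0,\omega_+$, right action determined by $\omega_ia=\sigma_i(a)\omega_i$, differential $d(a)=\partial_-(a)\omega_-+\partial_0(a)\omega_0+\partial_+(a)\omega_+$, and antilinear $*$-structure given by $\omega_\pm^*=\omega_\mp$, $\omega_0^*=-\omega_0$, $(a\omega b)^*=b^*\omega^*a^*$ (so that $d(a^* )=d(a)^*$). Spinor module: $\mathcal{S}=\mathcal{S}_+\oplus\mathcal{S}_-$ with $\mathcal{S}_+=\mathcal{A}(p;q)_{-1}\mathsf{s}_+$ and $\mathcal{S}_-=\mathcal{A}(p;q)_{1}\mathsf{s}_-$, where $\mathsf{s}_\pm$ are formal symbols commuting with elements of $\mathcal{B}(p;q)$ that distinguish the two components of the direct sum; thus elements of $\mathcal{S}$ are $a\mathsf{s}_++b\mathsf{s}_-$ with $a\in\mathcal{A}(p;q)_{-1}$, $b\in\mathcal{A}(p;q)_1$. Dirac operator, for parameters $\beta_+,\beta_-\in\mathbb{C}$: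 $$D(a\mathsf{s}_++b\mathsf{s}_-)=\beta_+q^{-1}\partial_+(b)\,\mathsf{s}_++\beta_-q\,\partial_-(a)\,\mathsf{s}_-.$$ Grading: $\gamma(a\mathsf{s}_++b\mathsf{s}_-)=a\mathsf{s}_+-b\mathsf{s}_-$ (one has $D\circ\gamma=-\gamma\circ D$). *)

(* Defs.v *)
From HB Require Import structures.
From mathcomp Require Import all_boot all_order all_algebra.
From mathcomp Require Import boolp finmap monalg.

Set Implicit Arguments.
Unset Strict Implicit.
Unset Printing Implicit Defensive.

Import Order.TTheory GRing.Theory Num.Theory.
Import Quotient.

Local Open Scope ring_scope.
Local Open Scope quotient_scope.

Section MalgAlgebra.
Variables (M : monomType) (K : comNzRingType).

Fact malg_scalerAr (c : K) (f g : {malg K[M]}) : c *: (f * g) = f * (c *: g).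
Proof.
rewrite -!mul_malgC mulrA [RHS]mulrA; congr (_ * _).
rewrite [f]monalgE mulr_sumr mulr_suml; apply: eq_bigr => k _.
by rewrite !malgM_def !fgmulUU mul1m mulm1 mulrC.
Qed.

End MalgAlgebra.

Inductive ideal_gen (F : nzRingType) (rel : F -> Prop) : F -> Prop :=
| ideal_gen_rel r : rel r -> ideal_gen rel r
| ideal_gen0 : ideal_gen rel 0
| ideal_genB f g : ideal_gen rel f -> ideal_gen rel g ->
    ideal_gen rel (f - g)
| ideal_genM a f b : ideal_gen rel f -> ideal_gen rel (a * f * b).

Definition qderiv (K : fieldType) (s : K) (p : {poly K}) : {poly K} :=
  (p \Po (s *: 'X) - p) %/ ((s - 1) *: 'X).

Definition qseparable (K : fieldType) (s : K) (p : {poly K}) : bool :=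
  coprimep p ('X * qderiv s p).

Inductive gen := Xp | Xm | Zp | Zm.

HB.instance Definition _ := gen_eqMixin gen.
HB.instance Definition _ := gen_choiceMixin gen.

Definition gen_deg (g : gen) : int :=
  match g with Xp | Zp => 1 | Xm | Zm => -1 end.

Section FreeAlgebra.
Variable K : fieldType.

Definition free_alg := {malg K[{fmonom gen}]}.
HB.instance Definition _ := GRing.Lalgebra.on free_alg.
HB.instance Definition _ := GRing.Lalgebra_isAlgebra.Build K free_alg
  (@malg_scalerAr _ K).

Fact gen_key : unit. Proof. exact: tt. Qed.
Definition fgen (g : gen) : free_alg := locked_with gen_key << fmu g >>.
Canonical fgen_unlockable g := [unlockable of fgen g].

Definition word_deg (w : {fmonom gen}) : int := \sum_(g <- (w : seq gen)) gen_deg g.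

Definition homogeneous (k : int) (f : free_alg) : Prop :=
  forall w, w \in msupp f -> word_deg w = k.
End FreeAlgebra.

Section FreeLift.
Variables (K : fieldType) (S : nzRingType) (f : {rmorphism K -> S}).
Variable h : gen -> S.

Definition word_eval (w : {fmonom gen}) : S := \prod_(g <- (w : seq gen)) h g.

Fact word_eval_multiplicative : mmorphism word_eval.
Proof. by split=> [v w|]; rewrite /word_eval (fmM, fm1) ?big_cat ?big_nil. Qed.
HB.instance Definition _ := isMultiplicative.Build {fmonom gen} S word_eval
  word_eval_multiplicative.

Definition free_lift : free_alg K -> S := mmap f word_eval.
HB.instance Definition _ := GRing.Additive.copy free_lift (mmap f word_eval).

Lemma free_lift_gen g : free_lift (fgen K g) = h g.
Proof.
rewrite /free_lift unlock (mmapU (f := f)) /= rmorph1 mul1r.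
by rewrite /word_eval fmU big_seq1.
Qed.

Hypothesis f_central : forall c s, GRing.comm (f c) s.

Lemma free_lift_monoid : monoid_morphism free_lift.
Proof.
by case: (@commr_mmap_is_multiplicative _ _ _ f word_eval) => [g m m'|fM f1];
  [exact: f_central | split].
Qed.
End FreeLift.

Section Algebra.
Variables (K : fieldType) (q : K) (p : {poly K}).

Local Notation F := (free_alg K).
Local Notation xp := (fgen K Xp).
Local Notation xm := (fgen K Xm).
Local Notation zp := (fgen K Zp).
Local Notation zm := (fgen K Zm).

Inductive Apq_rel : F -> Prop :=
| Apq_rel_zz : Apq_rel (zp * zm - zm * zp)
| Apq_rel_xpzp : Apq_rel (xp * zp - q^-1 *: (zp * xp))
| Apq_rel_xpzm : Apq_rel (xp * zm - q^-1 *: (zm * xp))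
| Apq_rel_xmzp : Apq_rel (xm * zp - q *: (zp * xm))
| Apq_rel_xmzm : Apq_rel (xm * zm - q *: (zm * xm))
| Apq_rel_xpxm : Apq_rel (xp * xm - horner_alg (zp * zm) p)
| Apq_rel_xmxp : Apq_rel (xm * xp - horner_alg (q ^+ 2 *: (zm * zp)) p).

Definition Apq_ideal : {pred F} := fun f => `[< ideal_gen Apq_rel f >].

Lemma Apq_idealP f : reflect (ideal_gen Apq_rel f) (f \in Apq_ideal).
Proof. exact: asboolP. Qed.

Fact Apq_ideal_zmod_closed : zmod_closed Apq_ideal.
Proof.
split=> [|f g /Apq_idealP If /Apq_idealP Ig]; apply/Apq_idealP.
  exact: ideal_gen0.
exact: ideal_genB.
Qed.
HB.instance Definition _ := GRing.isZmodClosed.Build F Apq_ideal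
  Apq_ideal_zmod_closed.

Lemma Apq_idealM a f b : f \in Apq_ideal -> a * f * b \in Apq_ideal.
Proof. by move=> /Apq_idealP If; apply/Apq_idealP/ideal_genM. Qed.

Lemma Apq_idealMl a f : f \in Apq_ideal -> a * f \in Apq_ideal.
Proof. by move=> If; rewrite -[a * f]mulr1 Apq_idealM. Qed.

Lemma Apq_idealMr f b : f \in Apq_ideal -> f * b \in Apq_ideal.
Proof. by move=> If; rewrite -[f]mul1r Apq_idealM. Qed.

Lemma Apq_idealZ c f : f \in Apq_ideal -> c *: f \in Apq_ideal.
Proof. by move=> If; rewrite -mulr_algl Apq_idealMl. Qed.

Fact Apq_proper : 1 \notin Apq_ideal.
Proof.
pose h g : K := match g with Xp => p`_0 | Xm => 1 | _ => 0 end.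
pose chi := free_lift idfun h.
have [chi1 chiM] : monoid_morphism chi.
  by apply: free_lift_monoid => c s; apply: mulrC.
have chiZ c f : chi (c *: f) = c * chi f.
  by rewrite -mul_malgC chiM /chi /free_lift mmapC.
have chi0 : chi 0 = 0 by exact: raddf0.
have chiD : {morph chi : f g / f + g} by exact: raddfD.
have chiB : {morph chi : f g / f - g} by exact: raddfB.
have chi_horner f P : chi (horner_alg f P) = P.[chi f].
  elim/poly_ind: P => [|P c IH]; first by rewrite rmorph0 chi0 horner0.
  rewrite rmorphD rmorphM /= horner_algX horner_algC chiD chiM IH /=.
  by rewrite chiZ chi1 mulr1 !hornerE.
have [chip chim chizp chizm] : [/\ chi xp = p`_0, chi xm = 1,
  chi zp = 0 & chi zm = 0] by rewrite /chi !free_lift_gen.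
clearbody chi; have chiI f : ideal_gen Apq_rel f -> chi f = 0.
  elim=> {f} [f| |f g _ If _ Ig|a f b _ If].
  - have comm0 (c : K) (z x : F) : chi z = 0 -> chi (x * z - c *: (z * x)) = 0.
      by move=> z0; rewrite chiB chiZ !chiM z0 !(mul0r, mulr0) subrr.
    have char0 (a b z : F) : chi a * chi b = p`_0 -> chi z = 0 ->
        chi (a * b - horner_alg z p) = 0.
      by move=> ab z0; rewrite chiB chi_horner chiM ab z0 horner_coef0 subrr.
    case; [| exact: comm0 | exact: comm0 | exact: comm0 | exact: comm0 | |].
    + by rewrite -[zm * zp]scale1r; apply: comm0.
    + apply: char0; first by rewrite chip chim mulr1.
      by rewrite (chiM zp) chizp mul0r.
    + apply: char0; first by rewrite chip chim mul1r.
      by rewrite chiZ (chiM zm) chizm mul0r mulr0.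
  - exact: chi0.
  - by rewrite chiB If Ig subrr.
  - by rewrite !chiM If mulr0 mul0r.
by apply/negP => /Apq_idealP/chiI/eqP; rewrite chi1 oner_eq0.
Qed.

Definition Apq := {quot Apq_ideal}.
HB.instance Definition _ := GRing.Zmodule.on Apq.
HB.instance Definition _ := EqQuotient.on Apq.

Definition Apq_one : Apq := lift_cst Apq 1.
Definition Apq_mul := lift_op2 Apq *%R.
Definition Apq_scale (c : K) := lift_op1 Apq ( *:%R c).

Lemma Apq_eqP (f g : F) : (\pi_Apq f = \pi_Apq g) <-> f - g \in Apq_ideal.
Proof.
split=> [/eqP|If]; first by rewrite piE.
by apply/eqP; rewrite piE.
Qed.

Lemma Apq_repr f : f - repr (\pi_Apq f) \in Apq_ideal.
Proof. by apply/Apq_eqP; rewrite reprK. Qed.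

Fact pi_Apq_mul : {morph \pi_Apq : f g / f * g >-> Apq_mul f g}.
Proof.
move=> f g; unlock Apq_mul; apply/Apq_eqP.
set f' := repr _; set g' := repr _.
have -> : f * g - f' * g' = f * (g - g') + (f - f') * g'.
  by rewrite mulrBr mulrBl addrA subrK.
by apply: rpredD; [apply: Apq_idealMl | apply: Apq_idealMr]; apply: Apq_repr.
Qed.
Canonical pi_Apq_mul_morph := PiMorph2 pi_Apq_mul.

Fact pi_Apq_scale c : {morph \pi_Apq : f / c *: f >-> Apq_scale c f}.
Proof.
move=> f; unlock Apq_scale; apply/Apq_eqP; rewrite -scalerBr.
exact/Apq_idealZ/Apq_repr.
Qed.
Canonical pi_Apq_scale_morph c := PiMorph1 (pi_Apq_scale c).
Canonical pi_Apq_one_morph := PiConst Apq_one.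

Fact Apq_mulA : associative Apq_mul.
Proof. by elim/quotW=> f; elim/quotW=> g; elim/quotW=> h; rewrite !piE mulrA. Qed.
Fact Apq_mul1r : left_id Apq_one Apq_mul.
Proof. by elim/quotW=> f; rewrite !piE mul1r. Qed.
Fact Apq_mulr1 : right_id Apq_one Apq_mul.
Proof. by elim/quotW=> f; rewrite !piE mulr1. Qed.
Fact Apq_mulDl : left_distributive Apq_mul +%R.
Proof. by elim/quotW=> f; elim/quotW=> g; elim/quotW=> h; rewrite !piE mulrDl. Qed.
Fact Apq_mulDr : right_distributive Apq_mul +%R.
Proof. by elim/quotW=> f; elim/quotW=> g; elim/quotW=> h; rewrite !piE mulrDr. Qed.
Fact Apq_one_neq0 : Apq_one != 0.
Proof.
have -> : Apq_one = \pi_Apq 1 by rewrite piE.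
have -> : 0 = \pi_Apq 0 by rewrite piE.
by apply/eqP => /Apq_eqP; rewrite subr0; apply/negP/Apq_proper.
Qed.
HB.instance Definition _ := GRing.Zmodule_isNzRing.Build Apq Apq_mulA Apq_mul1r
  Apq_mulr1 Apq_mulDl Apq_mulDr Apq_one_neq0.

Fact Apq_scalerA b c v : Apq_scale b (Apq_scale c v) = Apq_scale (b * c) v.
Proof. by elim/quotW: v => f; rewrite !piE scalerA. Qed.
Fact Apq_scale1r : left_id 1 Apq_scale.
Proof. by elim/quotW=> f; rewrite !piE scale1r. Qed.
Fact Apq_scalerDr : right_distributive Apq_scale +%R.
Proof. by move=> c; elim/quotW=> f; elim/quotW=> g; rewrite !piE scalerDr. Qed.
Fact Apq_scalerDl v : {morph Apq_scale^~ v : b c / b + c}.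
Proof. by move=> b c; elim/quotW: v => f; rewrite !piE scalerDl. Qed.
HB.instance Definition _ := GRing.Zmodule_isLmodule.Build K Apq Apq_scalerA
  Apq_scale1r Apq_scalerDr Apq_scalerDl.

Fact Apq_scalerAl c (a b : Apq) : c *: (a * b) = (c *: a) * b.
Proof.
elim/quotW: a => f; elim/quotW: b => g.
by rewrite -[LHS]/(Apq_scale c (Apq_mul _ _)) -[RHS]/(Apq_mul (Apq_scale c _) _)
  !piE scalerAl.
Qed.
HB.instance Definition _ := GRing.Lmodule_isLalgebra.Build K Apq Apq_scalerAl.

Fact Apq_scalerAr c (a b : Apq) : c *: (a * b) = a * (c *: b).
Proof.
elim/quotW: a => f; elim/quotW: b => g.
by rewrite -[LHS]/(Apq_scale c (Apq_mul _ _)) -[RHS]/(Apq_mul _ (Apq_scale c _))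
  !piE scalerAr.
Qed.
HB.instance Definition _ := GRing.Lalgebra_isAlgebra.Build K Apq Apq_scalerAr.

Definition Apq_pi : F -> Apq := \pi_Apq.
Fact Apq_pi_zmod : zmod_morphism Apq_pi.
Proof. by move=> f g; rewrite /Apq_pi !piE. Qed.
HB.instance Definition _ := GRing.isZmodMorphism.Build F Apq Apq_pi Apq_pi_zmod.
Fact Apq_pi_monoid : monoid_morphism Apq_pi.
Proof.
split=> [|f g]; first by rewrite /Apq_pi -[RHS]/Apq_one piE.
by rewrite /Apq_pi -[RHS]/(Apq_mul _ _) piE.
Qed.
HB.instance Definition _ := GRing.isMonoidMorphism.Build F Apq Apq_pi
  Apq_pi_monoid.
Fact Apq_pi_scalable : scalable Apq_pi.
Proof. by move=> c f; rewrite /Apq_pi -[RHS]/(Apq_scale _ _) piE. Qed.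
HB.instance Definition _ := GRing.isScalable.Build K F Apq *:%R Apq_pi
  Apq_pi_scalable.

Definition agen (g : gen) : Apq := Apq_pi (fgen K g).

Lemma Apq_piE f :
  Apq_pi f = \sum_(w <- msupp f) f@_w *: \prod_(g <- (w : seq gen)) agen g.
Proof.
have piW (w : seq gen) : Apq_pi << FMonom w >> = \prod_(g <- w) agen g.
  elim: w => [|g w IH]; first by rewrite -fmoneE big_nil (rmorph1 Apq_pi).
  rewrite big_cons -IH /agen -rmorphM; congr Apq_pi; rewrite unlock.
  by rewrite malgM_def fgmulUU mul1r; congr << _ >>; rewrite /mmul /= fmuE fmmulE.
rewrite {1}[f]monalgE; rewrite (raddf_sum Apq_pi); apply: eq_bigr => w _ /=.
have UE c (v : {fmonom gen}) : Apq_pi << c *g v >> = c *: Apq_pi << v >>.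
  rewrite -Apq_pi_scalable; congr Apq_pi.
  by rewrite -mul_malgC malgM_def fgmulUU mulr1 mul1m.
by rewrite UE -piW fmK.
Qed.

Lemma Apq_ind (P : Apq -> Prop) : P 0 ->
    (forall c a b, P a -> P b -> P (c *: a + b)) ->
    (forall s : seq gen, P (\prod_(g <- s) agen g)) -> forall a, P a.
Proof.
move=> P0 PD Pw a; rewrite -[a]reprK -[\pi _]/(Apq_pi _) Apq_piE.
elim: (enum_fset _) => [|w s IH]; rewrite ?big_nil // big_cons.
exact: PD.
Qed.

Definition homog (k : int) : {pred Apq} :=
  fun a => `[< exists2 f, homogeneous k f & a = Apq_pi f >].

Lemma homogP k a :
  reflect (exists2 f, homogeneous k f & a = Apq_pi f) (a \in homog k).
Proof. exact: asboolP. Qed.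

Fact homog_submod_closed k : submod_closed (homog k).
Proof.
split=> [|c a b /homogP[f hf ->] /homogP[g hg ->]]; apply/homogP.
  by exists 0; [move=> w; rewrite msupp0 inE | rewrite raddf0].
exists (c *: f + g); last by rewrite raddfD /= Apq_pi_scalable.
move=> w; rewrite -mcoeff_neq0 mcoeffD mcoeffZ => ww.
have [/hf //|/mcoeff_outdom fw] := boolP (w \in msupp f).
apply: hg; rewrite -mcoeff_neq0.
by apply: contra_neq ww => gw; rewrite fw gw mulr0 addr0.
Qed.
HB.instance Definition _ k := GRing.isSubmodClosed.Build K Apq (homog k)
  (homog_submod_closed k).

Lemma homog_word (s : seq gen) :
  \prod_(g <- s) agen g \in homog (\sum_(g <- s) gen_deg g).
Proof.
apply/homogP; exists << FMonom s >>.
  by move=> w; rewrite msuppU oner_eq0 inE => /eqP->.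
by rewrite Apq_piE msuppU oner_eq0 big_seq_fset1 mcoeffUU scale1r.
Qed.

Lemma homog_ind k (P : Apq -> Prop) : P 0 ->
    (forall c a b, P a -> P b -> P (c *: a + b)) ->
    (forall s : seq gen, \sum_(g <- s) gen_deg g = k ->
      P (\prod_(g <- s) agen g)) ->
  forall a, a \in homog k -> P a.
Proof.
move=> P0 PD Pw a /homogP[f hf ->]; rewrite Apq_piE big_seq.
elim/big_rec: _ => // w b /hf hw Pb; exact/PD/Pb/Pw.
Qed.

Lemma homog_gen g : agen g \in homog (gen_deg g).
Proof. by have := homog_word [:: g]; rewrite !big_seq1. Qed.

Lemma homog1 : 1 \in homog 0.
Proof. by have := homog_word [::]; rewrite !big_nil. Qed.

Lemma homogM j k a b : a \in homog j -> b \in homog k -> a * b \in homog (j + k).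
Proof.
move=> ha hb; elim/homog_ind: ha => [|c a1 a2 h1 h2|s <-].
- by rewrite mul0r rpred0.
- by rewrite mulrDl -scalerAl rpredD ?rpredZ.
elim/homog_ind: hb => [|c a1 a2 h1 h2|t <-].
- by rewrite mulr0 rpred0.
- by rewrite mulrDr -scalerAr rpredD ?rpredZ.
by have := homog_word (s ++ t); rewrite !big_cat.
Qed.

Definition zz : Apq := agen Zp * agen Zm.

Lemma homog_zz : zz \in homog 0.
Proof. by have := homogM (homog_gen Zp) (homog_gen Zm). Qed.

Lemma homog_horner a (P : {poly K}) : a \in homog 0 -> horner_alg a P \in homog 0.
Proof.
move=> ha; elim/poly_ind: P => [|P c IH]; first by rewrite rmorph0 rpred0.
rewrite rmorphD rmorphM /= horner_algX horner_algC.
by rewrite rpredD ?rpredZ ?homog1 // -[0]addr0 homogM.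
Qed.

Definition graded_scaling (lambda : K) (s : Apq -> Apq) : Prop :=
  forall k a, a \in homog k -> s a = lambda ^ k *: a.

Definition skew_derivation (s d : Apq -> Apq) : Prop :=
  forall a b, d (a * b) = d a * s b + a * d b.
End Algebra.

Arguments homog {K} q p k _.

Section Structures.
Variables (C : numClosedFieldType) (q : C) (p : {poly C}).

Local Notation A := (Apq q p).
Local Notation xp := (agen q p Xp).
Local Notation xm := (agen q p Xm).
Local Notation zp := (agen q p Zp).
Local Notation zm := (agen q p Zm).

Record star_structure := StarStructure {
  star : A -> A;
  star_antilinear : forall c a b, star (c *: a + b) = c^* *: star a + star b;
  starM : forall a b, star (a * b) = star b * star a;
  starK : involutive star;
  star_zm : star zm = zp;
  star_xm : star xm = xp
}.

Definition im : 'I_3 := @Ordinal 3 0 isT.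
Definition io : 'I_3 := @Ordinal 3 1 isT.
Definition ip : 'I_3 := @Ordinal 3 2 isT.

Definition cz : A := q *: horner_alg (zz q p) (qderiv (q ^+ 2) p).

Record calculus (alpha0 alphap alpham : C) := Calculus {
  sigma : 'I_3 -> {lrmorphism A -> A};
  sigma_m : graded_scaling q (sigma im);
  sigma_p : graded_scaling q (sigma ip);
  sigma_0 : graded_scaling (q ^+ 2) (sigma io);
  partial : 'I_3 -> {linear A -> A};
  partialM : forall i, skew_derivation (sigma i) (partial i);
  partial0_xp : partial io xp = alpha0 *: xp;
  partial0_xm : partial io xm = - (q ^- 2 * alpha0) *: xm;
  partial0_zp : partial io zp = alpha0 *: zp;
  partial0_zm : partial io zm = - (q ^- 2 * alpha0) *: zm;
  partialm_xp : partial im xp = 0;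
  partialm_zp : partial im zp = 0;
  partialm_xm : partial im xm = alpham *: (cz * zp);
  partialm_zm : partial im zm = alpham *: xp;
  partialp_xm : partial ip xm = 0;
  partialp_zm : partial ip zm = 0;
  partialp_xp : partial ip xp = alphap *: (cz * zm);
  partialp_zp : partial ip zp = alphap *: xm
}.

Section Degrees.

Lemma graded_scaling1 lambda (s : A -> A) : graded_scaling lambda s -> s 1 = 1.
Proof. by move=> hs; rewrite (hs _ _ (homog1 q p)) expr0z scale1r. Qed.

Lemma skew_derivation1 lambda (s d : A -> A) :
  graded_scaling lambda s -> skew_derivation s d -> d 1 = 0.
Proof.
move=> hs hd; have /eqP := hd 1 1.
by rewrite !mulr1 mul1r (graded_scaling1 hs) mulr1 -subr_eq subrr eq_sym => /eqP.
Qed.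

Lemma skew_derivation_homog lambda (s : A -> A) (d : {linear A -> A}) (j : int) :
    graded_scaling lambda s -> skew_derivation s d ->
    (forall g, d (agen q p g) \in homog q p (gen_deg g + j)) ->
  forall k a, a \in homog q p k -> d a \in homog q p (k + j).
Proof.
move=> hs hd hg k a; elim/homog_ind => [|c {}a b ha hb|w <-].
- by rewrite linear0 rpred0.
- by rewrite linearP rpredD ?rpredZ.
elim: w => [|g w IH]; first by rewrite !big_nil (skew_derivation1 hs hd) rpred0.
rewrite !big_cons hd rpredD // ?(hs _ _ (homog_word _ _ _)).
  by rewrite -scalerAr rpredZ // addrAC homogM // homog_word.
by rewrite -addrA homogM // homog_gen.
Qed.

Lemma cz_homog : cz \in homog q p 0.
Proof. by rewrite rpredZ // homog_horner // homog_zz. Qed.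

Section Partial.
Variables (alpha0 alphap alpham : C) (cal : calculus alpha0 alphap alpham).

Lemma partialm_homog k a : a \in homog q p k ->
  partial cal im a \in homog q p (k + 2).
Proof.
apply: (skew_derivation_homog (sigma_m cal)) => [|[]]; first exact: partialM.
- by rewrite partialm_xp rpred0.
- have -> : gen_deg Xm + 2 = 0 + 1 by [].
  rewrite partialm_xm rpredZ //.
  by rewrite homogM ?cz_homog ?(homog_gen _ _ Zp).
- by rewrite partialm_zp rpred0.
- by rewrite partialm_zm rpredZ // (homog_gen _ _ Xp).
Qed.

Lemma partialp_homog k a : a \in homog q p k ->
  partial cal ip a \in homog q p (k - 2).
Proof.
apply: (skew_derivation_homog (sigma_p cal)) => [|[]]; first exact: partialM.
- have -> : gen_deg Xp - 2 = 0 - 1 by [].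
  rewrite partialp_xp rpredZ //.
  by rewrite homogM ?cz_homog ?(homog_gen _ _ Zm).
- by rewrite partialp_xm rpred0.
- by rewrite partialp_zp rpredZ // (homog_gen _ _ Xm).
- by rewrite partialp_zm rpred0.
Qed.
End Partial.

Section Star.
Variable st : star_structure.

Lemma star0 : star st 0 = 0.
Proof.
have /eqP := star_antilinear st 1 0 0.
by rewrite rmorph1 !scale1r addr0 -subr_eq subrr eq_sym => /eqP.
Qed.

Lemma starD a b : star st (a + b) = star st a + star st b.
Proof. by rewrite -[a in LHS]scale1r star_antilinear rmorph1 scale1r. Qed.

Lemma starZ c a : star st (c *: a) = c^* *: star st a.
Proof. by rewrite -[c *: a]addr0 star_antilinear star0 addr0. Qed.

Lemma star1 : star st 1 = 1.
Proof. by have := starM st (star st 1) 1; rewrite mulr1 starK mulr1. Qed.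

Lemma star_homog k a : a \in homog q p k -> star st a \in homog q p (- k).
Proof.
elim/homog_ind => [|c {}a b ha hb|w <-].
- by rewrite star0 rpred0.
- by rewrite star_antilinear rpredD ?rpredZ.
elim: w => [|g w IH]; first by rewrite !big_nil star1 homog1.
rewrite !big_cons starM opprD addrC homogM //.
case: g; rewrite -?(star_zm st) -?(star_xm st) ?starK ?star_zm ?star_xm.
- exact: (homog_gen q p Xm).
- exact: (homog_gen q p Xp).
- exact: (homog_gen q p Zm).
- exact: (homog_gen q p Zp).
Qed.
End Star.
End Degrees.

Section Omega.
Variables (alpha0 alphap alpham : C) (cal : calculus alpha0 alphap alpham).

Definition Omega := 'rV[A]_3.

Definition omega (i : 'I_3) : Omega := delta_mx 0 i.

Definition omega_mulr (w : Omega) (a : A) : Omega :=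
  \row_i (w 0 i * sigma cal i a).

Definition diff (a : A) : Omega := \sum_i partial cal i a *: omega i.

Definition omega_star (st : star_structure) (w : Omega) : Omega :=
  \sum_i omega_mulr ((-1) ^+ (i == io) *: omega (rev_ord i)) (star st (w 0 i)).

End Omega.

Section Spinor.
Variables (alpha0 alphap alpham : C) (cal : calculus alpha0 alphap alpham).
Variable st : star_structure.

Definition component (k : int) := {a : A | a \in homog q p k}.
HB.instance Definition _ k := SubChoice.on (component k).
HB.instance Definition _ k := [SubChoice_isSubLmodule of component k by <:].

Definition Bpq := component 0.
Definition spinor := (component (-1) * component 1)%type.
HB.instance Definition _ := GRing.Lmodule.on spinor.

Definition spinor_pair (a b : A) (ha : a \in homog q p (-1))
  (hb : b \in homog q p 1) : spinor := (exist _ a ha, exist _ b hb).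

Fact lact_subproof (u : Bpq) k (a : component k) : val u * val a \in homog q p k.
Proof. by have := homogM (valP u) (valP a); rewrite add0r. Qed.

Definition lact (u : Bpq) (s : spinor) : spinor :=
  spinor_pair (lact_subproof u s.1) (lact_subproof u s.2).

Fact dirac_subproof1 c (b : component 1) :
  c *: partial cal ip (val b) \in homog q p (-1).
Proof. by rewrite rpredZ // (partialp_homog cal (valP b)). Qed.

Fact dirac_subproof2 c (a : component (-1)) :
  c *: partial cal im (val a) \in homog q p 1.
Proof. by rewrite rpredZ // (partialm_homog cal (valP a)). Qed.

Definition dirac (betap betam : C) (s : spinor) : spinor :=
  spinor_pair (dirac_subproof1 (betap * q^-1) s.2)
              (dirac_subproof2 (betam * q) s.1).

Definition grading (s : spinor) : spinor := (s.1, - s.2).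

Fact real_subproof c k (a : component k) : c *: star st (val a) \in homog q p (- k).
Proof. by rewrite rpredZ // star_homog // (valP a). Qed.

Definition real_op (nu : C) (s : spinor) : spinor :=
  spinor_pair (real_subproof (- nu^-1) s.2)
              (real_subproof nu s.1).

Definition opcomm (X Y : spinor -> spinor) (s : spinor) : spinor :=
  X (Y s) - Y (X s).
End Spinor.
End Structures.

Arguments star_structure {C} q p.
Arguments calculus {C} q p alpha0 alphap alpham.
Arguments Bpq {C} q p.
Arguments spinor {C} q p.
Arguments grading {C q p} s.

(* Main.v *)
Require Import Defs.
From mathcomp Require Import all_boot all_order all_algebra.
From mathcomp Require Import complex reals ring.

Set Implicit Arguments.
Unset Strict Implicit.

Import Order.TTheory GRing.Theory Num.Theory.

Local Open Scope ring_scope.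

(** Write [(a, b)] for the spinor [a s_+ + b s_-], and [a'] for the adjoint of
    [a] in the algebra.  Two facts carry the proof.

    The differential is compatible with the involution: [d(a') = d(a)'] reads,
    on the coefficient of [omega_+],
    [partial_+(a') = sigma_+((partial_- a)')] ([partialp_star]).  Both sides
    are antilinear and satisfy the same twisted Leibniz rule, because the
    involution reverses degrees and so turns [sigma_-] into the inverse of
    [sigma_+] ([sigma_star_sigma]); it remains to compare them on generators,
    where [alpha_-^* = q alpha_+] and the self-adjointness of [c(z)], which
    comes from [p] and [q] being real, give equality.  On the two components
    of the spinor module the automorphisms are the scalars [q] and [q^-1].  The
    number [nu] is real, since its square is positive; so [J D = D J] becomes a
    pair of scalar equations, namely the defining equation of [nu] and its
    complex conjugate ([real_op_dirac]).

    As [nu] is real, [J^2 = -1] and [J v J] is minus the right multiplication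
    by [v'] ([real_op_conj]).  On the other hand, [u] acts by left multiplication, and
    so does [[D, u]] up to an exchange of components: by the Leibniz rule it
    sends [(a, b)] to [(betap partial_+(u) b, betam partial_-(u) a)]
    ([dirac_commutator]).  Left and right multiplications commute, which gives
    both commutator identities. *)

(** * Real polynomials *)

Section RealPolynomials.
Variable C : numClosedFieldType.

Lemma map_poly_conj_real (p : {poly C}) :
  p \is a polyOver Num.real -> map_poly Num.conj p = p.
Proof.
by move=> /polyOverP pR; apply/polyP => i; rewrite coef_map /= conj_Creal.
Qed.

Lemma map_poly_conj_qderiv (s : C) (p : {poly C}) :
  s \is Num.real -> p \is a polyOver Num.real ->
  map_poly Num.conj (qderiv s p) = qderiv s p.
Proof.
move=> sR pR; rewrite /qderiv map_divp rmorphB /= map_comp_poly.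
rewrite !linearZ_LR /= !map_polyX rmorphB rmorph1 /=.
by rewrite map_poly_conj_real // conj_Creal.
Qed.

End RealPolynomials.

(** * The differential and the involution *)

Section StarCalculus.
Variables (C : numClosedFieldType) (q : C) (p : {poly C}).
Variables (alpha0 alphap alpham : C) (cal : calculus q p alpha0 alphap alpham).
Variable st : star_structure q p.

Local Notation A := (Apq q p).
Local Notation xp := (agen q p Xp).
Local Notation xm := (agen q p Xm).
Local Notation zp := (agen q p Defs.Zp).
Local Notation zm := (agen q p Zm).
Local Notation "a ^s" := (star st a) (at level 2, format "a ^s").

Lemma star_zp : zp ^s = zm.
Proof. by rewrite -(star_zm st) starK. Qed.

Lemma star_xp : xp ^s = xm.
Proof. by rewrite -(star_xm st) starK. Qed.

Lemma star_zz : (zz q p)^s = zz q p.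
Proof. by rewrite /zz starM star_zp star_zm. Qed.

Lemma zp_zm_comm : GRing.comm zp zm.
Proof.
apply/eqP; rewrite /agen -!(rmorphM (Apq_pi q p)); apply/eqP/Apq_eqP.
by apply/Apq_idealP/ideal_gen_rel/Apq_rel_zz.
Qed.

Lemma comm_horner_alg (a b : A) (P : {poly C}) :
  GRing.comm a b -> GRing.comm a (horner_alg b P).
Proof.
move=> ab; elim/poly_ind: P => [|P c IH].
  by rewrite rmorph0; apply: commr0.
rewrite rmorphD rmorphM /= horner_algX horner_algC.
apply: commrD; first exact: commrM.
by rewrite /GRing.comm -scalerAl -scalerAr mul1r mulr1.
Qed.

Lemma star_horner_alg (a : A) (P : {poly C}) :
  (horner_alg a P)^s = horner_alg (a^s) (map_poly Num.conj P).
Proof.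
elim/poly_ind: P => [|P c IH]; first by rewrite !rmorph0 star0.
rewrite !rmorphD !rmorphM /= map_polyX map_polyC /= !horner_algX !horner_algC.
rewrite starD starM IH starZ star1; congr (_ + _).
exact/comm_horner_alg/commr_refl.
Qed.

(** The involution sends [c(z) z_+] to [z_- c(z)], whereas the value of
    [partial_+] on [x_+] has the factors in the other order. *)
Lemma zm_cz_comm : GRing.comm zm (cz q p).
Proof.
rewrite /GRing.comm /cz -scalerAr -scalerAl; congr (_ *: _).
apply: comm_horner_alg; apply: commrM => //.
exact/commr_sym/zp_zm_comm.
Qed.

Hypotheses (qR : q \is Num.real) (q_neq0 : q != 0).
Hypothesis pR : p \is a polyOver Num.real.
Hypothesis alphaE : alpham^* = q * alphap.

Lemma star_cz : (cz q p)^s = cz q p.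
Proof.
have q2R : q ^+ 2 \is Num.real by rewrite realX.
rewrite /cz starZ star_horner_alg star_zz (map_poly_conj_qderiv q2R pR).
by rewrite (conj_Creal qR).
Qed.

(** The involution sends degree [k] to [-k], so it conjugates the scaling
    [q^k] into its inverse; [q] being real, nothing else changes. *)
Lemma sigma_star_sigma (a : A) :
  sigma cal ip ((sigma cal im a)^s) = a^s.
Proof.
elim/Apq_ind: a => [|c a b IHa IHb|w].
- by rewrite linear0 star0 linear0.
- by rewrite linearP 2!star_antilinear linearP /= IHa IHb.
have hw := homog_word q p w.
rewrite (sigma_m cal hw) starZ linearZ /= (sigma_p cal (star_homog st hw)).
have qkR k : q ^ k \is Num.real by rewrite rpredXz.
by rewrite scalerA (conj_Creal (qkR _)) -expfzDr // subrr expr0z scale1r.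
Qed.

(** The [omega_+]-coefficient of [d(a') = d(a)']. *)
Lemma partialp_star (a : A) :
  partial cal ip (a^s) = sigma cal ip ((partial cal im a)^s).
Proof.
elim/Apq_ind: a => [|c a b IHa IHb|w].
- by rewrite star0 !linear0 star0 linear0.
- by rewrite star_antilinear !linearP star_antilinear linearP /= IHa IHb.
elim: w => [|g w IH].
  rewrite big_nil star1 (skew_derivation1 (sigma_m cal) (partialM cal im)).
  by rewrite (skew_derivation1 (sigma_p cal) (partialM cal ip)) star0 linear0.
rewrite big_cons starM !(partialM cal) starD !starM rmorphD !rmorphM /=.
rewrite sigma_star_sigma -IH addrC; congr (_ * _ + _) => {IH w}.
have homogN1 b : b \in homog q p (-1) -> sigma cal ip b = q^-1 *: b.
  by move=> hb; rewrite (sigma_p cal hb) exprN1.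
case: g.
- by rewrite star_xp partialp_xm partialm_xp star0 linear0.
- rewrite star_xm partialp_xp partialm_xm starZ starM star_zp star_cz.
  rewrite linearZ /= homogN1; last first.
    by rewrite -[-1]addr0 (homogM (homog_gen q p Zm)) // cz_homog.
  by rewrite scalerA alphaE [q * _]mulrC mulfK // zm_cz_comm.
- by rewrite star_zp partialp_zm partialm_zp star0 linear0.
- rewrite star_zm partialp_zp partialm_zm starZ star_xp linearZ /=.
  by rewrite homogN1 ?(homog_gen q p Xm) // scalerA alphaE [q * _]mulrC mulfK.
Qed.

Lemma partialp_star_homogN1 (a : A) : a \in homog q p (-1) ->
  partial cal ip (a^s) = q^-1 *: (partial cal im a)^s.
Proof.
move=> ha; rewrite partialp_star.
by rewrite (sigma_p cal (star_homog st (partialm_homog cal ha))) exprN1.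
Qed.

(** This is the [omega_-]-coefficient of [d(b') = d(b)'], obtained from the
    [omega_+]-coefficient for [b'] because the involution is involutive. *)
Lemma partialm_star_homog1 (b : A) : b \in homog q p 1 ->
  partial cal im (b^s) = q *: (partial cal ip b)^s.
Proof.
move=> /(star_homog st) hb; have := partialp_star_homogN1 hb.
rewrite starK => ->; rewrite starZ starK scalerA.
by rewrite conj_Creal ?rpredV // divff // scale1r.
Qed.

End StarCalculus.

(** * Operators on spinors *)

Section Spinors.
Variables (C : numClosedFieldType) (q : C) (p : {poly C}).
Variables (alpha0 alphap alpham : C) (cal : calculus q p alpha0 alphap alpham).
Variable st : star_structure q p.
Variables betap betam nu : C.

Local Notation "a ^s" := (star st a) (at level 2, format "a ^s").
Local Notation D := (dirac cal betap betam).
Local Notation J := (real_op st nu).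

Lemma spinor_eq (s t : spinor q p) :
  val s.1 = val t.1 -> val s.2 = val t.2 -> s = t.
Proof. by case: s t => [a b] [c d] /= /val_inj -> /val_inj ->. Qed.

Lemma real_op_antilinear (c : C) (s t : spinor q p) :
  J (c *: s + t) = c^* *: J s + J t.
Proof.
by apply: spinor_eq => /=; rewrite star_antilinear scalerDr !scalerA mulrC.
Qed.

Lemma real_op_grading (s : spinor q p) : J (grading s) = - grading (J s).
Proof.
apply: spinor_eq => /=; last by rewrite opprK.
by rewrite -[- val s.2]scaleN1r starZ rmorphN1 scaleN1r scalerN.
Qed.

Hypotheses (nuR : nu \is Num.real) (nu_neq0 : nu != 0).

(** The involution reverses products, so conjugating a left multiplication by
    [J] gives a right multiplication; the sign is that of [J^2]. *)
Lemma real_op_conj (v : Bpq q p) (s : spinor q p) :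
  val (J (lact v (J s))).1 = - (val s.1 * (val v)^s) /\
  val (J (lact v (J s))).2 = - (val s.2 * (val v)^s).
Proof.
split=> /=; rewrite starM starZ starK -scalerAl scalerA.
  by rewrite conj_Creal // mulNr mulVf // scaleN1r.
by rewrite conj_Creal ?rpredN ?rpredV // mulrN divff // scaleN1r.
Qed.

Lemma real_opK (s : spinor q p) : J (J s) = - s.
Proof.
apply: spinor_eq => /=; rewrite starZ starK scalerA.
  by rewrite conj_Creal // mulNr mulVf // scaleN1r.
by rewrite conj_Creal ?rpredN ?rpredV // mulrN divff // scaleN1r.
Qed.

Lemma lact_real_op_comm (u v : Bpq q p) (s : spinor q p) :
  opcomm (lact u) (J \o lact v \o J) s = 0.
Proof.
have [e1 e2] := real_op_conj v s.
have [f1 f2] := real_op_conj v (lact u s).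
apply/eqP; rewrite /opcomm subr_eq0; apply/eqP.
apply: spinor_eq; first by rewrite [RHS]f1 /= [X in _ * X]e1 mulrN mulrA.
by rewrite [RHS]f2 /= [X in _ * X]e2 mulrN mulrA.
Qed.

Hypothesis q_neq0 : q != 0.

(** The powers of [q] in the Dirac operator are exactly those which cancel the
    twist of the Leibniz rule, [sigma_+] on degree [1] and [sigma_-] on degree
    [-1]. *)
Lemma dirac_commutator (u : Bpq q p) (s : spinor q p) :
  val (opcomm D (lact u) s).1 = betap *: (partial cal ip (val u) * val s.2) /\
  val (opcomm D (lact u) s).2 = betam *: (partial cal im (val u) * val s.1).
Proof.
split=> /=; rewrite (partialM cal) scalerDr -[in X in _ - X]scalerAr addrK.
  rewrite (sigma_p cal (valP s.2)) expr1z -scalerAr scalerA.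
  by rewrite (divfK q_neq0).
rewrite (sigma_m cal (valP s.1)) exprN1 -scalerAr scalerA.
by rewrite (mulfK q_neq0).
Qed.

Lemma dirac_real_op_comm (u v : Bpq q p) (s : spinor q p) :
  opcomm (opcomm D (lact u)) (J \o lact v \o J) s = 0.
Proof.
have [e1 e2] := real_op_conj v s.
have [f1 f2] := real_op_conj v (opcomm D (lact u) s).
have [g1 g2] := dirac_commutator u s.
have [h1 h2] := dirac_commutator u (J (lact v (J s))).
apply/eqP; rewrite [opcomm (opcomm _ _) _ _]/opcomm subr_eq0; apply/eqP.
apply: spinor_eq.
  by rewrite [LHS]h1 [RHS]f1 g1 e2 mulrN scalerN mulrA scalerAl.
by rewrite [LHS]h2 [RHS]f2 g2 e1 mulrN scalerN mulrA scalerAl.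
Qed.

Hypothesis qR : q \is Num.real.
Hypothesis pR : p \is a polyOver Num.real.
Hypothesis alphaE : alpham^* = q * alphap.
Hypothesis betap_neq0 : betap != 0.
Hypothesis nuE : nu ^+ 2 = - q ^+ 3 * (betam^* / betap).

Lemma real_op_dirac (s : spinor q p) : J (D s) = D (J s).
Proof.
have nuE1 : nu ^+ 2 * betap = - q ^+ 3 * betam^*.
  by rewrite nuE -mulrA divfK.
(* Conjugating the previous equation leaves [nu] and [q] fixed. *)
have nuE2 : nu ^+ 2 * betap^* = - q ^+ 3 * betam.
  rewrite -[in LHS](conj_Creal nuR) -rmorphXn -rmorphM nuE1 rmorphM rmorphN.
  by rewrite rmorphXn /= conjCK conj_Creal.
have conj_betamq : (betam * q)^* = betam^* * q.
  by rewrite rmorphM /= (conj_Creal qR).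
have conj_betapq : (betap * q^-1)^* = betap^* * q^-1.
  by rewrite rmorphM /= (conj_Creal (rpredVr qR)).
apply: spinor_eq => /=; rewrite linearZ starZ /= !scalerA.
  rewrite (partialp_star_homogN1 cal st qR q_neq0 pR alphaE (valP s.1)).
  rewrite scalerA conj_betamq; apply: (congr1 ( *:%R^~ _)).
  have -> : betam^* = - q ^- 3 * (nu ^+ 2 * betap) by rewrite nuE1; field.
  by field; rewrite q_neq0.
rewrite (partialm_star_homog1 cal st qR q_neq0 pR alphaE (valP s.2)).
rewrite scalerA conj_betapq; apply: (congr1 ( *:%R^~ _)).
have -> : betam = - q ^- 3 * (nu ^+ 2 * betap^*) by rewrite nuE2; field.
by field; rewrite nu_neq0 q_neq0.
Qed.

End Spinors.

(** * KO-dimension two *)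

Theorem proposition5p3 (R : realType) (q : R) (p : {poly R[i]})
    (alpha0 : R) (alphap alpham betap betam nu : R[i])
    (st : star_structure q%:C%C p)
    (cal : calculus q%:C%C p alpha0%:C%C alphap alpham) :
  0 < q < 1 ->
  p \is a polyOver Num.real ->
  qseparable (q%:C%C ^+ 2) p ->
  alpha0 != 0 -> alphap != 0 -> alpham != 0 ->
  alpham^* = q%:C%C * alphap ->
  betam^* / betap < 0 ->
  nu ^+ 2 = - q%:C%C ^+ 3 * (betam^* / betap) ->
  let D := dirac cal betap betam in
  let J := real_op st nu in
  [/\ forall (c : R[i]) (s t : spinor q%:C%C p),
        J (c *: s + t) = c^* *: J s + J t,
      forall s, J (J s) = - s,
      forall s, J (grading s) = - grading (J s),
      forall s, J (D s) = D (J s)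
    & forall (u v : Bpq q%:C%C p) (s : spinor q%:C%C p),
        opcomm (lact u) (J \o lact v \o J) s = 0 /\
        opcomm (opcomm D (lact u)) (J \o lact v \o J) s = 0].
Proof.
move=> /andP[q_gt0 _] pR _ _ _ _ alphaE beta_lt0 nuE D J.
have qR : q%:C%C \is Num.real by apply: gtr0_real; rewrite ltcR.
have q_neq0 : q%:C%C != 0 by apply: lt0r_neq0; rewrite ltcR.
have betap_neq0 : betap != 0.
  by apply: contraTneq beta_lt0 => ->; rewrite invr0 mulr0 ltxx.
have nu2_gt0 : 0 < nu ^+ 2.
  by rewrite nuE nmulr_rgt0 // oppr_lt0 exprn_gt0 // ltcR.
have nuR : nu \is Num.real by rewrite realEsqr ltW.
have nu_neq0 : nu != 0 by rewrite -sqrf_eq0 lt0r_neq0.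
split=> [c s t|s|s|s|u v s].
- exact: real_op_antilinear.
- exact: real_opK.
- exact: real_op_grading.
- exact: (real_op_dirac cal st nuR nu_neq0 q_neq0 qR pR alphaE betap_neq0 nuE).
- split; first exact: lact_real_op_comm.
  exact: dirac_real_op_comm.
Qed.
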